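(* Let $\Sigma=\{c_1,\dots,c_\sigma\}$ be a finite alphabet, $s\in\Sigma^n$ a primitive string, and for every string $x$ over $\Sigma$ let $\pi_x$ be a total order of $\Sigma$. Suppose we are given $BWT_{*}(s)$ with constant-time rank support and the set of orderings $\pi_x$ used to compute $M_{*}(s)$. Then, given any string $x=x_1x_2\cdots x_p$, the range $R[x]$ of rows of $M_{*}(s)$ prefixed by $x$ can be computed in ${\cal O}(\sigma p^2)$ time and ${\cal O}(\sigma p)$ space.
   Context: A string is primitive if all its cyclic rotations are distinct. $M_{*}(s)$ is the $n\times n$ matrix whose rows (numbered $1,\dots,n$ top to bottom) are the cyclic rotations of $s$, sorted as follows: for distinct rotations $u\neq v$ with longest common prefix $x$ ($|x|<n$) and next symbols $a$ in $u$ and $b$ in $v$, $u$ precedes $v$ iff $a$ precedes $b$ in $\pi_x$. $BWT_{*}(s)=L$ is the last column of $M_{*}(s)$. For a string $x$, the rows having $x$ as a prefix form a contiguous block; $R[x]=[b_x,\ell_x]$ means that row $j$ is prefixed by $x$ iff $b_x\le j<b_x+\ell_x$, and $R[x]=[0,0]$ if no row is prefixed by $x$. $\mathsf{rank}_c(L,j)$ is the number of occurrences of $c$ in $L[1,j]$; constant-time rank support means such queries take ${\cal O}(1)$ time. Model: word RAM with word size $w$, $\sigma=w^{{\cal O}(1)}$. *)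

(* Defs.v *)
From mathcomp Require Import all_boot.

Set Implicit Arguments.
Unset Strict Implicit.
Unset Printing Implicit Defensive.

(* The alphabet {c_1, ..., c_sigma} is 'I_sigma.  An ordering family gives, for
   every context y, the non-strict order relation of pi_y.                    *)
Definition orderings (sigma : nat) := seq 'I_sigma -> rel 'I_sigma.

Definition total_order (T : eqType) (r : rel T) : Prop :=
  [/\ antisymmetric r, transitive r & total r].

Definition rotations (T : Type) (s : seq T) : seq (seq T) :=
  [seq rot i s | i <- iota 0 (size s)].

Definition primitive (T : eqType) (s : seq T) : bool := uniq (rotations s).

(* Length of the longest common prefix. *)
Definition lcp (T : eqType) (u v : seq T) : nat :=
  find (fun ab => ab.1 != ab.2) (zip u v).

(* "u = v, or u precedes v"; on strings of the same length the default branch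
   is reached only when u = v.                                                *)
Definition row_le (sigma : nat) (pi : orderings sigma) (u v : seq 'I_sigma) :
    bool :=
  let k := lcp u v in
  match onth u k, onth v k with
  | Some a, Some b => pi (take k u) a b
  | _, _ => true
  end.

(* The matrix M_*(s), as the list of its rows from top to bottom. *)
Definition Mstar (sigma : nat) (pi : orderings sigma) (s : seq 'I_sigma) :
    seq (seq 'I_sigma) :=
  sort (row_le pi) (rotations s).

Definition last_column (T : Type) (M : seq (seq T)) : seq T :=
  pmap (fun row => ohead (rev row)) M.

Definition BWTstar (sigma : nat) (pi : orderings sigma) (s : seq 'I_sigma) :
    seq 'I_sigma :=
  last_column (Mstar pi s).

(* R[x] = [b, l] in M; rows are numbered from 1.  The first clause ranges over
   all naturals j, so that it determines b and l as soon as some row is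
   prefixed by x.                                                             *)
Definition is_range (T : eqType) (M : seq (seq T)) (x : seq T) (b l : nat) :
    Prop :=
  (forall j, (0 < j <= size M) && prefix x (nth [::] M j.-1)
             = (b <= j < b + l))
  /\ (~~ has (prefix x) M -> b = 0 /\ l = 0).

(* Word RAM.  Words are naturals below 2 ^ w.  Registers are named directly in
   the program text, so a program has O(1) of them; memory is accessed
   indirectly.                                                                *)
Inductive binop := Add | Sub | Mul | Div | Mod | Eq | Lt.

Definition eval_binop (w : nat) (o : binop) (a b : nat) : nat :=
  (match o with
   | Add => a + b
   | Sub => a + 2 ^ w - b
   | Mul => a * b
   | Div => a %/ b
   | Mod => a %% b
   | Eq => a == b
   | Lt => a < b
   end) %% 2 ^ w.

(* All arguments of type reg are register names. *)
Definition reg := nat.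

Inductive prog :=
  | Const (r : reg) (k : nat)
  | Bin (o : binop) (r a b : reg)
  | Read (r a : reg)
  | Write (a r : reg)
  | Access (r j : reg)
  | Rank (r c j : reg)
  | Order (r a m k : reg)
  | Seq (P Q : prog)
  | If (r : reg) (P Q : prog)
  | While (r : reg) (P : prog).

Record state := State { regs : reg -> nat; mem : nat -> nat }.

Definition upd (f : nat -> nat) (i v : nat) : nat -> nat :=
  fun j => if j == i then v else f j.

Definition set_reg (st : state) (r : reg) (v : nat) : state :=
  State (upd (regs st) r v) (mem st).

Definition set_mem (st : state) (a v : nat) : state :=
  State (regs st) (upd (mem st) a v).

Definition codes (sigma : nat) (y : seq 'I_sigma) : seq nat :=
  [seq nat_of_ord c | c <- y].

(* rank_c(L, j): the number of occurrences of c in L[1, j]. *)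
Definition rank (L : seq nat) (c j : nat) : nat := count_mem c (take j L).

(* The symbols listed in the order given by r. *)
Definition listing (sigma : nat) (r : rel 'I_sigma) : seq 'I_sigma :=
  sort r (enum 'I_sigma).

(* exec w S L pi P st st' t: on a machine with w-bit words and S memory cells,
   P started in st halts in st' after t unit-cost steps.  Addressing a cell
   outside the S available ones blocks the execution, so a halting execution
   runs in space S.
   The inputs L and pi are reachable only through Access (L[j]), Rank, and
   Order; the latter returns the k-th symbol (from 0) of the ordering pi_y,
   where y is the string held by the m consecutive cells starting at a.       *)
Inductive exec (w S sigma : nat) (L : seq 'I_sigma) (pi : orderings sigma) :
    prog -> state -> state -> nat -> Prop :=
  | exec_Const r k st :
      exec w S L pi (Const r k) st (set_reg st r (k %% 2 ^ w)) 1
  | exec_Bin o r a b st :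
      exec w S L pi (Bin o r a b) st
        (set_reg st r (eval_binop w o (regs st a) (regs st b))) 1
  | exec_Read r a st :
      regs st a < S ->
      exec w S L pi (Read r a) st (set_reg st r (mem st (regs st a))) 1
  | exec_Write a r st :
      regs st a < S ->
      exec w S L pi (Write a r) st (set_mem st (regs st a) (regs st r)) 1
  | exec_Access r j st :
      0 < regs st j <= size L ->
      exec w S L pi (Access r j) st
        (set_reg st r (nth 0 (codes L) (regs st j).-1)) 1
  | exec_Rank r c j st :
      exec w S L pi (Rank r c j) st
        (set_reg st r (rank (codes L) (regs st c) (regs st j))) 1
  | exec_Order r a m k st (y : seq 'I_sigma) :
      regs st a + regs st m <= S ->
      codes y = [seq mem st i | i <- iota (regs st a) (regs st m)] ->
      regs st k < sigma ->
      exec w S L pi (Order r a m k) st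
        (set_reg st r (nth 0 (codes (listing (pi y))) (regs st k))) 1
  | exec_Seq P Q st1 st2 st3 t1 t2 :
      exec w S L pi P st1 st2 t1 -> exec w S L pi Q st2 st3 t2 ->
      exec w S L pi (Seq P Q) st1 st3 (t1 + t2)
  | exec_If r P Q st st' t :
      exec w S L pi (if regs st r != 0 then P else Q) st st' t ->
      exec w S L pi (If r P Q) st st' t.+1
  | exec_While0 r P st :
      regs st r = 0 -> exec w S L pi (While r P) st st 1
  | exec_WhileS r P st1 st2 st3 t1 t2 :
      regs st1 r != 0 ->
      exec w S L pi P st1 st2 t1 -> exec w S L pi (While r P) st2 st3 t2 ->
      exec w S L pi (While r P) st1 st3 (t1 + t2).+1.

(* Registers 0, 1, 2 hold n, sigma, p; the pattern x occupies the cells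
   0, ..., p - 1; everything else is 0.                                       *)
Definition init (sigma n : nat) (x : seq 'I_sigma) : state :=
  State (nth 0 [:: n; sigma; size x]) (nth 0 (codes x)).

(* Main.v *)
From mathcomp Require Import all_boot zify.
Require Import Defs.

(* The rows prefixed by d z are the cyclic shifts of the rows prefixed by z that
   end with d, so two rank queries on R[z] give the length of R[d z], as long
   as z is shorter than n (a pattern longer than n has an empty range).  Within
   R[y] the rows are sorted by pi_y on the symbol that follows y, so the start
   of R[y c] is the start of R[y] plus the lengths of the R[y a] for a before c
   in pi_y.  Hence the ranges R[x_i..x_(j-1) c], for all symbols c, follow from
   the ranges R[x_(i+1)..x_(j-1) c] and the start of R[x_i..x_(j-1)].  Running
   through j = 1, ..., p and i = j, ..., 1 takes sigma p^2 such steps, and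
   needs two tables of size sigma and one of size p. *)

Set Implicit Arguments.
Unset Strict Implicit.
Unset Printing Implicit Defensive.

(** * Longest common prefixes *)

Lemma lcpC (T : eqType) (u v : seq T) : lcp u v = lcp v u.
Proof.
elim: u v => [|a u IHu] [|b v] //=; rewrite /lcp /= eq_sym.
by case: ifP => // _; congr _.+1; apply: IHu.
Qed.

Lemma take_lcp (T : eqType) (u v : seq T) :
  take (lcp u v) u = take (lcp u v) v.
Proof.
elim: u v => [|a u IHu] [|b v] //; rewrite /lcp /=.
by have [<-|] := eqVneq a b => //=; congr (_ :: _); apply: IHu.
Qed.

Lemma lcp_cat (T : eqType) (y u v : seq T) :
  lcp (y ++ u) (y ++ v) = size y + lcp u v.
Proof. by elim: y => //= a y IHy; rewrite /lcp /= eqxx; congr _.+1. Qed.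

(** * The order of the rows *)

Section RowOrder.

Variables (sigma : nat) (pi : orderings sigma).
Hypothesis pi_total : forall y, total_order (pi y).

(** The longest common prefix is the same string for [u, v] and for [v, u], so both comparisons
    consult the same ordering, which is total. This is what makes the sorted matrix sorted. *)
Lemma row_le_total : total (row_le pi).
Proof.
move=> u v; rewrite /row_le (lcpC v u) -take_lcp.
case: (onth u _) => [a|]; case: (onth v _) => [b|] //.
by case: (pi_total (take (lcp u v) u)) => _ _; apply.
Qed.

(** If the symbols after [y] differ, then [y] is the longest common prefix and [row_le] consults
    [pi y]; if they agree, reflexivity of [pi y] suffices. *)
Lemma row_le_next y u v c :
    prefix y u -> prefix y v -> size y < size u -> size y < size v ->
  row_le pi u v -> pi y (nth c u (size y)) (nth c v (size y)).
Proof.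
case/prefixP=> u' ->; case/prefixP=> v' ->; rewrite !size_cat.
case: u' => [|a u']; first by rewrite addn0 ltnn.
case: v' => [|b v']; first by rewrite addn0 ltnn.
move=> _ _; rewrite !nth_cat ltnn subnn /=.
have [<- _|neq_ab] := eqVneq a b.
  by case: (pi_total y) => _ _ tot; have := tot a a; rewrite orbb.
rewrite /row_le lcp_cat {1 2 3}/lcp /= neq_ab addn0.
by rewrite !onth_cat ltnn subnn /= take_size_cat.
Qed.

End RowOrder.

(** * Listings of an ordering and sorted sequences *)

Lemma mem_listing (sigma : nat) (r : rel 'I_sigma) c : c \in listing r.
Proof. by rewrite mem_sort mem_enum. Qed.

Lemma listing_uniq (sigma : nat) (r : rel 'I_sigma) : uniq (listing r).
Proof. by rewrite sort_uniq enum_uniq. Qed.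

Lemma size_listing (sigma : nat) (r : rel 'I_sigma) : size (listing r) = sigma.
Proof. by rewrite size_sort size_enum_ord. Qed.

Lemma count_mem_seq (T : eqType) (o k : seq T) :
  uniq o -> count [in o] k = \sum_(c <- o) count_mem c k.
Proof.
elim: o => [|a o IHo] /= => [_|/andP[a_o uniq_o]].
  by rewrite big_nil count_pred0.
rewrite big_cons -IHo // -count_predUI [X in _ + X](eq_count (a2 := pred0)) => [|c /=].
  by rewrite count_pred0 addn0; apply: eq_count => c; rewrite /= inE.
by case: eqVneq => //= ->; apply: negbTE.
Qed.

(** Both sides are sorted by [r] and are permutations of each other, so they coincide by
    antisymmetry. This locates the copies of [c] in [k]: they come right after the symbols of
    [o1]. *)
Lemma sorted_split_listing (sigma : nat) (r : rel 'I_sigma) o1 c o2 k :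
    total_order r -> listing r = o1 ++ c :: o2 -> sorted r k ->
  k = filter [in o1] k ++ filter (pred1 c) k ++ filter [in o2] k.
Proof.
move=> [r_anti r_trans r_total] def_o k_sorted.
have := sort_sorted r_total (enum 'I_sigma); rewrite -/(listing r) def_o.
rewrite sorted_pairwise // pairwise_cat allrel_consr /=.
case/and3P=> /andP[/allP o1c /allrelP o12] _ /andP[/allP co2 _].
have rr a : r a a by have := r_total a a; rewrite orbb.
apply: (sorted_eq r_trans r_anti) => //.
  rewrite sorted_pairwise // !pairwise_cat -!sorted_pairwise //.
  rewrite !(sorted_filter r_trans) // !andbT allrel_catr -andbA.
  apply/and3P; split; apply/allrelP => a b; rewrite !mem_filter /= => /andP[Ha _] /andP[Hb _].
  - by rewrite (eqP Hb); apply: o1c.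
  - exact: o12.
  - by rewrite (eqP Ha); apply: co2.
(* Every symbol lies in exactly one of [o1], [[:: c]] and [o2], since the listing is duplicate-free
   and complete. *)
apply/permP => P; rewrite !count_cat; elim: k {k_sorted} => //= a k ->.
have := listing_uniq r; rewrite def_o cat_uniq /= negb_or.
case/and4P=> _ /andP[c_o1 /hasPn o2_o1] c_o2 _.
have := mem_listing r a; rewrite def_o mem_cat inE.
have [-> _|_ /=] := eqVneq a c.
  by rewrite (negbTE c_o1) (negbTE c_o2) /=; lia.
have [a_o2 _|_] := boolP (a \in o2).
  by rewrite (negbTE (o2_o1 _ a_o2)) /=; lia.
by rewrite orbF => -> /=; lia.
Qed.

(** * Cyclic shifts of rotations, and differences of ranks *)

Lemma perm_rotr_rotations (T : eqType) (t : seq T) :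
  perm_eq (map (rotr 1) (rotations t)) (rotations t).
Proof.
suff /(perm_map (rotr 1)): perm_eq (rotations t) (map (rot 1) (rotations t)).
  by rewrite (mapK (rotK 1)).
have -> : map (rot 1) (rotations t) = [seq rot i t | i <- iota 1 (size t)].
  rewrite (iotaDl 1 0) -!map_comp; apply/eq_in_map => i.
  by rewrite mem_iota add0n => lt_it /=; rewrite add1n -rotS.
(* The shifted list ends with the rotation by [size t], which is [t] itself, the head of the
   original list. *)
rewrite /rotations; case def_m: (size t) => [//|m].
rewrite -[m in iota 1 m]addn1 iotaD map_cat /= add1n -def_m rot_size rot0.
by rewrite cats1 perm_sym perm_rcons.
Qed.

Lemma rank_add L c b l :
  rank L c (b + l) = rank L c b + count_mem c (take l (drop b L)).
Proof. by rewrite /rank takeD count_cat. Qed.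

(** * Blocks of rows with a common prefix *)

Section Blocks.

Variables (sigma n : nat) (pi : orderings sigma) (s : seq 'I_sigma).
Hypothesis pi_total : forall y, total_order (pi y).
Hypothesis size_s : size s = n.

Local Notation M := (Mstar pi s).

Definition occ (y : seq 'I_sigma) := count (prefix y) M.

(* The rows prefixed by y are those at positions b, ..., b + occ y - 1, counted
   from 0; b is only bounded, not determined, when there is no such row. *)
Definition block (y : seq 'I_sigma) (b : nat) : Prop :=
  b + occ y <= n /\ all (prefix y) (take (occ y) (drop b M)).

Lemma size_Mstar : size M = n.
Proof. by rewrite size_sort size_map size_iota. Qed.

Lemma size_Mstar_row r : r \in M -> size r = n.
Proof. by rewrite mem_sort => /mapP[i _ ->]; rewrite size_rot. Qed.

(** By its size a block already contains all [occ y] rows prefixed by [y], so the rows outside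
    contribute nothing. *)
Lemma count_block y b P :
  block y b -> count (predI P (prefix y)) (take (occ y) (drop b M)) =
               count (predI P (prefix y)) M.
Proof.
case=> b_le; rewrite all_count => /eqP.
rewrite size_takel ?size_drop ?size_Mstar => [eq_occ|]; last by lia.
set A := take b M; set B := take _ _ in eq_occ *; set C := drop (occ y) (drop b M).
have def_M : M = A ++ B ++ C by rewrite !cat_take_drop.
have := erefl (occ y); rewrite {1}/occ {1}def_M !count_cat eq_occ => out.
have le_prefix D : count (predI P (prefix y)) D <= count (prefix y) D.
  by apply: sub_count => r /= /andP[].
by rewrite def_M !count_cat; have := le_prefix A; have := le_prefix C; lia.
Qed.

Lemma occ_nil : occ [::] = n.
Proof. by rewrite /occ -size_Mstar -count_predT; apply: eq_count => -[]. Qed.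

Lemma block_nil : block [::] 0.
Proof. by rewrite /block occ_nil; split=> //; apply/allP => -[]. Qed.

Lemma BWTstarE c : 0 < n -> BWTstar pi s = map (last c) M.
Proof.
move=> n_gt0; rewrite /BWTstar /last_column.
have: all (fun r => size r == n) M by apply/allP => r /size_Mstar_row->.
elim: M => //= r M' IH /andP[/eqP size_r /IH->].
by case/lastP: r size_r => [|r a] /= => [e|_]; [lia|rewrite rev_rcons last_rcons].
Qed.

(** The map [rotr 1] permutes the rows and brings the last symbol to the front. As [size y < n], the
    prefix [y] does not involve that last symbol, so a row starts with [y] and ends with [c] exactly
    when its image starts with [c :: y]. *)
Lemma block_cons y b (c : 'I_sigma) : block y b -> size y < n ->
  rank (codes (BWTstar pi s)) c (b + occ y) =
  rank (codes (BWTstar pi s)) c b + occ (c :: y).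
Proof.
move=> yb lt_yn; have n_gt0 : 0 < n by lia.
rewrite rank_add; congr (_ + _).
rewrite (BWTstarE c) // /codes -map_comp -map_drop -map_take count_map.
have [_ all_y] := yb.
rewrite (eq_in_count (a2 := predI (fun r => last c r == c) (prefix y))); last first.
  by move=> r /(allP all_y) /= ->; rewrite andbT.
rewrite (count_block _ yb) /occ !count_sort -[RHS](permP (perm_rotr_rotations s)) [RHS]count_map.
apply: eq_in_count => r /mapP[i _ def_r].
have: size r = n by rewrite def_r size_rot.
case/lastP: r {def_r} => [|r a]; first by move=> /= ?; lia.
rewrite size_rcons /= last_rcons rotr1_rcons prefix_cons eq_sym => size_r.
congr (_ && _); rewrite -cats1 !prefixE takel_cat //.
by rewrite -ltnS size_r.
Qed.

(** The symbols that follow [y] in its block are sorted by [pi y], so the rows continuing with [c]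
    come right after those continuing with a symbol of [o1]. *)
Lemma block_rcons y b o1 c o2 : block y b -> size y < n ->
    listing (pi y) = o1 ++ c :: o2 ->
  block (rcons y c) (b + \sum_(a <- o1) occ (rcons y a)).
Proof.
move=> yb lt_yn def_o; have [le_b all_y] := yb.
set B := take _ _ in all_y; pose next r := nth c r (size y).
have size_B : size B = occ y.
  by rewrite size_takel // size_drop size_Mstar; lia.
have rowB r : r \in B -> prefix y r && (size r == n).
  move=> Br; rewrite (allP all_y) //=.
  by rewrite (size_Mstar_row (mem_drop (mem_take Br))).
have prefix_next a r : size r = n -> prefix (rcons y a) r = (next r == a) && prefix y r.
  move=> size_r; rewrite !prefixE size_rcons (take_nth c) ?size_r //.
  by rewrite eqseq_rcons andbC.
have occE a : occ (rcons y a) = count_mem a (map next B).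
  rewrite count_map -(eq_in_count (a1 := predI (fun r => next r == a) (prefix y))).
    rewrite (count_block _ yb); apply: eq_in_count => r /size_Mstar_row size_r.
    by rewrite prefix_next.
  by move=> r /(allP all_y) /= ->; rewrite andbT.
have uniq_o1 : uniq o1.
  by have := listing_uniq (pi y); rewrite def_o cat_uniq => /andP[].
under eq_bigr => a _ do rewrite occE.
rewrite -count_mem_seq // /block occE.
have sorted_B : sorted (pi y) (map next B).
  have := sort_sorted (row_le_total pi_total) (rotations s).
  move=> /(drop_sorted b) /(take_sorted (occ y)).
  apply: (homo_sorted_in (P := [in B])); last exact/allP.
  move=> u v /rowB /andP[yu /eqP size_u] /rowB /andP[yv /eqP size_v].
  by apply: row_le_next; rewrite ?size_u ?size_v.
have := sorted_split_listing (pi_total y) def_o sorted_B.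
set kB := map next B; set l := count_mem c kB; set m := count _ kB => def_kB.
have le_ml : m + l <= occ y.
  rewrite -size_B -(size_map next) -/kB def_kB !size_cat !size_filter.
  by rewrite -/m -/l addnA leq_addr.
split; first by lia.
have -> : take l (drop (b + m) M) = take l (drop m B).
  by rewrite /B addnC -drop_drop [in LHS]take_drop [in RHS]take_drop take_takel 1?addnC.
have: all (pred1 c) (take l (drop m kB)).
  rewrite def_kB drop_size_cat ?size_filter // take_size_cat ?size_filter //.
  exact: filter_all.
rewrite /kB -map_drop -map_take all_map => /allP next_c.
apply/allP => r Br; have /rowB/andP[yr /eqP size_r] := mem_drop (mem_take Br).
by rewrite prefix_next // yr andbT; apply: next_c.
Qed.

(** Blocks count positions from 0 and [is_range] counts rows from 1, whence [b.+1]. Since the block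
    holds all [occ y] rows, none lies before or after it. *)
Lemma block_range y b : block y b -> 0 < occ y ->
  is_range M y b.+1 (occ y).
Proof.
move=> [le_b all_y] occ_gt0; split; last by rewrite has_count -/(occ y) occ_gt0.
set A := take b M; set B := take _ _ in all_y; set C := drop (occ y) (drop b M).
have def_M : M = A ++ B ++ C by rewrite !cat_take_drop.
have size_A : size A = b by rewrite size_takel // size_Mstar; lia.
have size_B : size B = occ y by rewrite size_takel // size_drop size_Mstar; lia.
have := erefl (occ y); rewrite {1}/occ {1}def_M !count_cat.
rewrite (eqP (etrans (esym (all_count _ _)) all_y)) size_B => out.
have noA : ~~ has (prefix y) A by rewrite has_count; lia.
have noC : ~~ has (prefix y) C by rewrite has_count; lia.
case=> [|j] /=; first by lia.
have [lt_jn|ge_jn] := ltnP j (size M).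
  rewrite def_M !nth_cat size_A size_B; case: ifP => [lt_jb|ge_jb].
    by rewrite (negbTE (hasPn noA _ (mem_nth _ _))) ?size_A //; lia.
  case: ifP => [lt_jl|ge_jl].
    by rewrite (allP all_y) ?mem_nth ?size_B //; lia.
  rewrite (negbTE (hasPn noC _ (mem_nth _ _))); first by lia.
  by move: lt_jn; rewrite !size_drop size_Mstar; lia.
by move: ge_jn; rewrite size_Mstar; lia.
Qed.

End Blocks.

(** * Rules for terminating executions with a time bound *)

Section Runs.

Variables (w S sigma : nat) (L : seq 'I_sigma) (pi : orderings sigma).

(** The final state is passed to a postcondition, so that rules can be nested and a program is
    followed instruction by instruction. *)
Definition runs (P : prog) (T : nat) (st : state) (Q : state -> Prop) : Prop :=
  exists st' t, [/\ exec w S L pi P st st' t, t <= T & Q st'].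

Lemma runs_le P T T' st Q : T <= T' -> runs P T st Q -> runs P T' st Q.
Proof. by move=> le_T [st' [t [ex le_t Qst']]]; exists st', t; split=> //; lia. Qed.

Lemma runs_imp P T st (Q Q' : state -> Prop) :
  (forall st', Q st' -> Q' st') -> runs P T st Q -> runs P T st Q'.
Proof. by move=> QQ' [st' [t [ex le_t /QQ']]]; exists st', t. Qed.

Lemma runs_seq P P' T T' st Q :
  runs P T st (fun st' => runs P' T' st' Q) -> runs (Seq P P') (T + T') st Q.
Proof.
move=> [st1 [t1 [ex1 le1 [st2 [t2 [ex2 le2 Qst2]]]]]].
by exists st2, (t1 + t2); split=> //; [apply: exec_Seq ex1 ex2|lia].
Qed.

Lemma runs_seq1 P P' T st Q :
  runs P 1 st (fun st' => runs P' T st' Q) -> runs (Seq P P') T.+1 st Q.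
Proof. by rewrite -add1n; apply: runs_seq. Qed.

Lemma runs_if r P P' T st Q :
  runs (if regs st r != 0 then P else P') T st Q -> runs (If r P P') T.+1 st Q.
Proof.
by move=> [st' [t [ex le_t Qst']]]; exists st', t.+1; split=> //; apply: exec_If.
Qed.

(* Loops that count the register r down to 0; I m is the invariant when r
   holds m. *)
Lemma runs_while (I : nat -> state -> Prop) r P T m st :
    (forall m' st', I m' st' -> regs st' r = m') ->
    (forall m' st', m' < m -> I m'.+1 st' -> runs P T st' (I m')) ->
  I m st -> runs (While r P) (m * T.+1).+1 st (I 0).
Proof.
move=> I_r; elim: m st => [|m IHm] st stepP Im.
  by exists st, 1; split=> //; apply: exec_While0; rewrite (I_r _ _ Im).
have [st1 [t1 [ex1 le1 I1]]] := stepP _ _ (ltnSn m) Im.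
have [|st2 [t2 [ex2 le2 I2]]] := IHm _ _ I1.
  by move=> m' st' lt_m'; apply: stepP; lia.
exists st2, (t1 + t2).+1; split=> //; last by lia.
by apply: exec_WhileS ex1 ex2; rewrite (I_r _ _ Im).
Qed.

Lemma runs_const r k st (Q : state -> Prop) :
  k < 2 ^ w -> Q (set_reg st r k) -> runs (Const r k) 1 st Q.
Proof.
move=> lt_k Qst; exists (set_reg st r (k %% 2 ^ w)), 1; rewrite modn_small //.
by split=> //; have := exec_Const w S L pi r k st; rewrite modn_small.
Qed.

Lemma runs_bin o v r a b st (Q : state -> Prop) :
  eval_binop w o (regs st a) (regs st b) = v -> Q (set_reg st r v) ->
  runs (Bin o r a b) 1 st Q.
Proof. by move=> <- Qst; eexists _, 1; split; [apply: exec_Bin| |]. Qed.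

Lemma runs_add v r a b st (Q : state -> Prop) :
    regs st a + regs st b = v -> v < 2 ^ w -> Q (set_reg st r v) ->
  runs (Bin Add r a b) 1 st Q.
Proof. by move=> def_v lt_v; apply: (runs_bin (v := v)); rewrite /eval_binop /= def_v modn_small. Qed.

(** Machine subtraction is modulo [2 ^ w]; writing the minuend as [v] plus the subtrahend expresses
    that it does not wrap around. *)
Lemma runs_sub v r a b st (Q : state -> Prop) :
    regs st a = v + regs st b -> regs st a < 2 ^ w -> Q (set_reg st r v) ->
  runs (Bin Sub r a b) 1 st Q.
Proof.
move=> def_v lt_v; apply: (runs_bin (v := v)); rewrite /eval_binop /= addnC -addnBA; last by lia.
by rewrite modnDl def_v addnK modn_small //; lia.
Qed.

Lemma runs_lt r a b st (Q : state -> Prop) : 1 < 2 ^ w ->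
  Q (set_reg st r (regs st a < regs st b)) -> runs (Bin Lt r a b) 1 st Q.
Proof.
move=> gt1; apply: (runs_bin (v := (regs st a < regs st b))).
rewrite /eval_binop /= modn_small //; case: (regs st a < regs st b) => //.
exact: ltnW.
Qed.

Lemma runs_read v r a st (Q : state -> Prop) :
    regs st a < S -> mem st (regs st a) = v -> Q (set_reg st r v) ->
  runs (Read r a) 1 st Q.
Proof. by move=> lt_a <- Qst; eexists _, 1; split; [apply: exec_Read| |]. Qed.

Lemma runs_write a r st (Q : state -> Prop) :
    regs st a < S -> Q (set_mem st (regs st a) (regs st r)) ->
  runs (Write a r) 1 st Q.
Proof. by move=> lt_a Qst; eexists _, 1; split; [apply: exec_Write| |]. Qed.

Lemma runs_rank v r c j st (Q : state -> Prop) :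
    rank (codes L) (regs st c) (regs st j) = v -> Q (set_reg st r v) ->
  runs (Rank r c j) 1 st Q.
Proof. by move=> <- Qst; eexists _, 1; split; [apply: exec_Rank| |]. Qed.

Lemma runs_order v r a m k st (y : seq 'I_sigma) (Q : state -> Prop) :
    regs st a + regs st m <= S ->
    codes y = [seq mem st i | i <- iota (regs st a) (regs st m)] ->
    regs st k < sigma -> nth 0 (codes (listing (pi y))) (regs st k) = v ->
    Q (set_reg st r v) ->
  runs (Order r a m k) 1 st Q.
Proof.
by move=> le_S def_y lt_k <- Qst; eexists _, 1; split; [apply: exec_Order def_y _| |].
Qed.

End Runs.

Arguments runs_const {w S sigma L pi r k st Q}.
Arguments runs_add {w S sigma L pi v r a b st Q}.
Arguments runs_sub {w S sigma L pi v r a b st Q}.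
Arguments runs_lt {w S sigma L pi r a b st Q}.
Arguments runs_read {w S sigma L pi v r a st Q}.
Arguments runs_write {w S sigma L pi a r st Q}.
Arguments runs_rank {w S sigma L pi v r c j st Q}.
Arguments runs_order {w S sigma L pi v r a m k st y Q}.

(** * The program *)

Notation "P ;; Q" := (Seq P Q) (at level 60, right associativity).

(* Positions i, j in x start from 0, and x[i, j) is x_i ... x_(j-1).
   Registers: 3 = p - j, 7 = j, 4 = i, 17 = j - i, 15 = p + i, 5 = number of
   symbols c still to be processed, 12 = start of the next range R[x[i, j) c],
   24 = length of the last range; 6, 18, 19, 20 hold 1, 2p, 2p + sigma, 0.
   Memory, after x: cell p + i holds the start of R[x[i, j)]; cells 2p + c and
   2p + sigma + c hold the start and the length of R[x[i, j) c].
   The innermost loop updates the entry of c from i + 1 to i in place; for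
   i = j there is no previous entry, and R of the empty string is used. *)
Definition inner_body : prog :=
  Bin Sub 16 1 5 ;; Order 8 4 17 16 ;; Bin Add 13 18 8 ;; Bin Add 14 19 8 ;;
  (If 17 (Read 9 4 ;; Read 10 13 ;; Read 11 14)
         (Bin Add 9 8 20 ;; Const 10 0 ;; Bin Add 11 0 20)) ;;
  Bin Add 21 10 11 ;; Rank 22 9 21 ;; Rank 23 9 10 ;; Bin Sub 11 22 23 ;;
  Write 13 12 ;; Write 14 11 ;; Bin Add 12 12 11 ;; Bin Sub 5 5 6.

(** Once the tables hold R[x[i, j) c] for all c, the entry of c = x_j is R[x[i, j + 1)]; its start
    replaces the old one in cell p + i, ready for the next j. *)
Definition middle_body : prog :=
  Bin Sub 4 4 6 ;; Bin Sub 17 7 4 ;; Bin Add 15 2 4 ;; Read 12 15 ;;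
  Bin Add 5 1 20 ;; While 5 inner_body ;;
  Read 8 7 ;; Bin Add 13 18 8 ;; Read 12 13 ;; Write 15 12 ;;
  Bin Add 14 19 8 ;; Read 24 14.

Definition outer_body : prog :=
  Bin Sub 7 2 3 ;; Bin Add 4 7 6 ;; While 4 middle_body ;; Bin Sub 3 3 6.

(** Register 24 starts with n, the length of the range of the empty string, and cell p with 0, its
    start; this answers p = 0. Patterns longer than n are rejected at once. *)
Definition range_prog : prog :=
  Const 6 1 ;; Bin Add 18 2 2 ;; Bin Add 19 18 1 ;; Bin Add 24 0 20 ;;
  Bin Lt 25 0 2 ;;
  If 25 (Const 0 0 ;; Const 1 0)
     (Bin Add 3 2 20 ;; While 3 outer_body ;; Read 12 2 ;;
      If 24 (Bin Add 0 12 6 ;; Bin Add 1 24 20) (Const 0 0 ;; Const 1 0)).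

(** * Factors of the pattern, and bounds on ranks *)

Definition factor (T : Type) (x : seq T) i j := take (j - i) (drop i x).

Lemma factor_nil (T : Type) (x : seq T) i j : j <= i -> factor x i j = [::].
Proof. by move=> le_ji; rewrite /factor (eqP le_ji) take0. Qed.

Lemma size_factor (T : Type) (x : seq T) i j :
  j <= size x -> size (factor x i j) = j - i.
Proof. by move=> le_jp; rewrite size_takel // size_drop; lia. Qed.

Lemma factor_rcons sigma (x : seq 'I_sigma) i j : i <= j < size x ->
  exists2 c : 'I_sigma, nth 0 (codes x) j = c &
    factor x i j.+1 = rcons (factor x i j) c.
Proof.
case/andP=> le_ij lt_jp; have c0 : 'I_sigma by case: x lt_jp.
exists (nth c0 x j); first by rewrite (nth_map c0).
rewrite /factor subSn // (take_nth c0) ?size_drop ?ltn_sub2r // ?nth_drop ?subnKC //.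
exact: leq_ltn_trans lt_jp.
Qed.

Lemma factor_cons sigma (x : seq 'I_sigma) i j : i < j <= size x ->
  exists2 c : 'I_sigma, nth 0 (codes x) i = c &
    factor x i j = c :: factor x i.+1 j.
Proof.
case/andP=> lt_ij le_jp; have lt_ip : i < size x by lia.
have c0 : 'I_sigma by case: x lt_ip {le_jp}.
exists (nth c0 x i); first by rewrite (nth_map c0).
by rewrite /factor (drop_nth c0) // -subSS subSn.
Qed.

Lemma codes_factor sigma (x : seq 'I_sigma) i j : j <= size x -> i <= j ->
  codes (factor x i j) = [seq nth 0 (codes x) l | l <- iota i (j - i)].
Proof.
move=> le_jp le_ij; rewrite /codes map_nth_iota ?size_map; last by lia.
by rewrite map_take map_drop.
Qed.

Lemma rank_le_size L c j : rank L c j <= size L.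
Proof.
rewrite -{2}(cat_take_drop j L) size_cat /rank.
exact: leq_trans (count_size _ _) (leq_addr _ _).
Qed.

Lemma size_BWTstar sigma (pi : orderings sigma) s :
  size (BWTstar pi s) <= size s.
Proof.
by rewrite size_pmap (leq_trans (count_size _ _)) // (size_Mstar _ (erefl _)).
Qed.

(** * Loop invariants and correctness *)

Section Correctness.

Variables (w S sigma n p : nat) (pi : orderings sigma) (s x : seq 'I_sigma).
Hypothesis pi_total : forall y, total_order (pi y).
Hypothesis size_s : size s = n.
Hypothesis size_x : size x = p.
Hypothesis lt_nw : n < 2 ^ w.
Hypothesis le_Sw : S <= 2 ^ w.

Local Notation L := (BWTstar pi s).
Local Notation occ := (occ pi s).
Local Notation block := (block n pi s).
Local Notation runs := (runs w S L pi).
Local Arguments upd f i v j /.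

Definition consts (st : state) : Prop :=
  [/\ regs st 0 = n, regs st 1 = sigma, regs st 2 = p & regs st 6 = 1] /\
  [/\ regs st 18 = p + p, regs st 19 = p + p + sigma, regs st 20 = 0
    & forall i, i < p -> mem st i = nth 0 (codes x) i].

(** The middle loop goes down in i, so cells from index [i] on already refer to factors ending at
    [j + 1], the others to factors ending at [j]. *)
Definition starts (i j : nat) (st : state) : Prop :=
  forall i', i' < p -> block (factor x i' (j + (i <= i'))) (mem st (p + i')).

Definition entry (y : seq 'I_sigma) (st : state) (c : 'I_sigma) : Prop :=
  mem st (p + p + sigma + c) = occ (rcons y c) /\
  block (rcons y c) (mem st (p + p + c)).

(** Here [o] lists the symbols already processed. As the tables are updated in place, the other
    symbols still have their entries for [i.+1], which exist only if [i < j]. *)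
Definition inner_inv (i j b m : nat) (st : state) : Prop :=
  let y := factor x i j in
  let o := take (sigma - m) (listing (pi y)) in
  [/\ consts st,
      [/\ regs st 3 = p - j, regs st 7 = j, regs st 4 = i & regs st 15 = p + i],
      [/\ regs st 17 = j - i, regs st 5 = m
        & regs st 12 = b + \sum_(a <- o) occ (rcons y a)],
      starts i.+1 j st
    & forall c, if c \in o then entry y st c
                else i < j -> entry (factor x i.+1 j) st c].

Lemma inner_body_correct i j b m st :
    i <= j < p -> p <= n -> p + p + sigma + sigma <= S -> m < sigma ->
    block (factor x i j) b -> inner_inv i j b m.+1 st ->
  runs inner_body 16 st (inner_inv i j b m).
Proof.
case/andP=> le_ij lt_jp le_pn le_S lt_m yb.
set y := factor x i j in yb *; set o := listing (pi y).
have c0 : 'I_sigma by exists m.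
(* Register 5 counts down while the listing is read upwards: with [m.+1] symbols left, the next one
   is at position [k] below. *)
have size_o : size o = sigma by apply: size_listing.
pose k := sigma - m.+1; pose c := nth c0 o k; have lt_c := ltn_ord c.
have def_k : sigma - m = k.+1 by rewrite /k; lia.
have lt_k : k < size o by rewrite size_o /k; lia.
have def_o : o = take k o ++ c :: drop k.+1 o.
  by rewrite -drop_nth ?cat_take_drop.
have take_o : take k.+1 o = rcons (take k o) c by rewrite (take_nth c0).
have c_o : c \notin take k o.
  have := listing_uniq (pi y); rewrite -/o {1}def_o uniq_catC /= mem_cat negb_or.
  by case/andP=> /andP[_ ->].
have size_y : size y = j - i by rewrite size_factor ?size_x; lia.
have lt_yn : size y < n by lia.
have yc_block := block_rcons pi_total size_s yb lt_yn def_o.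
case=> -[[r0 r1 r2 r6] [r18 r19 r20 mem_x]] [r3 r7 r4 r15].
rewrite -/y -/o -/k /= => -[r17 r5 r12] startsP entryP.
have := entryP c; rewrite (negbTE c_o) => entry_c.
rewrite /inner_body.
apply/runs_seq1/(runs_sub (v := k)) => /=; [rewrite r1 r5 /k; lia|rewrite r1; lia|].
apply/runs_seq1/(runs_order (y := y) (v := c)) => /=.
- by rewrite r4 r17; lia.
- rewrite r4 r17 codes_factor ?size_x //; last by lia.
  by apply/eq_in_map => l; rewrite mem_iota => ?; rewrite mem_x //; lia.
- by rewrite -size_o.
- by rewrite (nth_map c0).
apply/runs_seq1/(runs_add (v := p + p + c)) => /=; [by rewrite r18|lia|].
apply/runs_seq1/(runs_add (v := p + p + sigma + c)) => /=; [by rewrite r19|lia|].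
set st1 := set_reg _ _ _.
(* Both branches leave a first symbol [d] and the range of a string [z] with [d :: z = rcons y c]:
   for [i = j], [d] is [c] and [z] is empty. *)
pose Q st' := exists (d : 'I_sigma) b' z, [/\ block z b', rcons y c = d :: z, size z < n
   & st' = set_reg (set_reg (set_reg st1 9 d) 10 b') 11 (occ z)].
apply: (runs_seq (T := 4) (T' := 8)); apply: (runs_imp (Q := Q)); last first.
  apply: runs_if; rewrite /= r17 subn_eq0; have [lt_ij|le_ji] /= := ltnP i j.
    have [|d def_d def_y] := @factor_cons _ x i j; first by rewrite size_x; lia.
    have [occ_c block_c] := entry_c lt_ij.
    apply/runs_seq1/(runs_read (v := d)) => /=; [rewrite r4; lia|rewrite r4 mem_x; [by []|lia]|].
    apply/runs_seq1/(runs_read (v := mem st (p + p + c))) => /=; [lia|by []|].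
    apply: (runs_read (v := occ (rcons (factor x i.+1 j) c))) => /=; [lia|by []|].
    exists d, (mem st (p + p + c)), (rcons (factor x i.+1 j) c).
    split=> //; first by rewrite /y def_y.
    by rewrite size_rcons size_factor ?size_x; lia.
  have y_nil : y = [::] by rewrite /y factor_nil //; lia.
  apply/runs_seq1/(runs_add (v := c)) => /=; [by rewrite r20 addn0|lia|].
  apply/runs_seq1/runs_const => /=; first by lia.
  apply: (runs_add (v := occ [::])) => /=.
  - by rewrite r0 r20 addn0 (occ_nil _ size_s).
  - by rewrite (occ_nil _ size_s).
  exists c, 0, [::]; split=> //; [exact: block_nil|by rewrite y_nil|exact: leq_ltn_trans lt_yn].
move=> st' [d [b' [z [zb def_dz lt_zn ->]]]].
have [le_b' _] := zb; have [le_cur _] := yc_block.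
have rank_lt a l : rank (codes L) a l < 2 ^ w.
  apply: leq_ltn_trans lt_nw; rewrite (leq_trans (rank_le_size _ _ _)) // size_map.
  by rewrite -size_s size_BWTstar.
apply/runs_seq1/(runs_add (v := b' + occ z)) => /=; [by []|lia|].
apply/runs_seq1/(runs_rank (erefl _)) => /=.
apply/runs_seq1/(runs_rank (erefl _)) => /=.
apply/runs_seq1/(runs_sub (v := occ (rcons y c))) => /=.
- by rewrite (block_cons size_s d zb) // def_dz addnC.
- exact: rank_lt.
apply/runs_seq1/runs_write => /=; first by lia.
apply/runs_seq1/runs_write => /=; first by lia.
apply/runs_seq1/(runs_add (erefl _)) => /=; first by rewrite r12; lia.
apply: (runs_sub (v := m)) => /=; [by rewrite r5 r6 addn1|rewrite r5; lia|].
rewrite /inner_inv -/y -/o def_k take_o; split=> /=.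
- split; split=> //= l lt_lp; rewrite !ifN_eq ?mem_x //; lia.
- by [].
- by split; rewrite // r12 big_rcons /=; lia.
- by move=> l lt_lp /=; rewrite !ifN_eq; [apply: startsP|lia|lia].
move=> a; rewrite mem_rcons inE /entry /=.
have [-> /=|neq_ac /=] := eqVneq a c.
  by rewrite eqxx ifN_eq ?eqxx ?r12; [|lia].
have lt_a := ltn_ord a; have ne : nat_of_ord a <> c by move=> /val_inj/eqP; rewrite (negbTE neq_ac).
by rewrite !ifN_eq; [apply: entryP|lia..].
Qed.

Definition middle_inv (j i : nat) (st : state) : Prop :=
  [/\ consts st, [/\ regs st 3 = p - j, regs st 7 = j & regs st 4 = i],
      starts i j st
    & i <= j -> (forall c, entry (factor x i j) st c) /\
                regs st 24 = occ (factor x i j.+1)].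

Lemma middle_body_correct i j st :
    i <= j < p -> p <= n -> p + p + sigma + sigma <= S ->
    middle_inv j i.+1 st ->
  runs middle_body (17 * sigma + 12) st (middle_inv j i).
Proof.
move=> lt_ijp le_pn le_S; have /andP[le_ij lt_jp] := lt_ijp.
case=> -[[r0 r1 r2 r6] [r18 r19 r20 mem_x]] [r3 r7 r4] startsP entryP.
have lt_ip : i < p by lia.
(* Cell [p + i] is not yet updated in this pass, so it still refers to the factor ending at [j]. *)
have yb : block (factor x i j) (mem st (p + i)).
  by have := startsP i lt_ip; rewrite ltnn addn0.
(* Five instructions, [sigma] rounds of 16 steps plus a test, a final test, and six instructions. *)
rewrite (_ : 17 * sigma + 12 = 5 + ((sigma * 17).+1 + 6)); last by lia.
apply/runs_seq1/(runs_sub (v := i)) => /=; [by rewrite r4 r6 addn1|rewrite r4; lia|].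
apply/runs_seq1/(runs_sub (v := j - i)) => /=; [rewrite r7; lia|rewrite r7; lia|].
apply/runs_seq1/(runs_add (v := p + i)) => /=; [by rewrite r2|lia|].
apply/runs_seq1/(runs_read (v := mem st (p + i))) => /=; [lia|by []|].
apply/runs_seq1/(runs_add (v := sigma)) => /=; [by rewrite r1 r20 addn0|lia|].
apply: runs_seq; apply: (runs_imp (Q := inner_inv i j (mem st (p + i)) 0)); last first.
  apply: runs_while => [m st' [_ _ [_ -> _]] //|m st' lt_m|].
    by apply: inner_body_correct.
  rewrite /inner_inv subnn take0 big_nil addn0; split=> //= c lt_ij.
  by have [entry_c _] := entryP lt_ij; apply: entry_c.
move=> {startsP entryP}st' [] [[r0' r1' r2' r6'] [r18' r19' r20' mem_x']].
move=> [r3' r7' r4' r15'] [r17' r5' r12'] startsP.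
rewrite subn0 take_oversize ?size_listing // => entryP.
have {}entryP c : entry (factor x i j) st' c by have := entryP c; rewrite mem_listing.
have [|c def_c def_y] := @factor_rcons _ x i j; first by rewrite size_x.
have [occ_c block_c] := entryP c; have lt_c := ltn_ord c.
apply/runs_seq1/(runs_read (v := c)) => /=; [rewrite r7'; lia|by rewrite r7' mem_x'|].
apply/runs_seq1/(runs_add (v := p + p + c)) => /=; [by rewrite r18'|lia|].
apply/runs_seq1/(runs_read (v := mem st' (p + p + c))) => /=; [lia|by []|].
apply/runs_seq1/runs_write => /=; first by rewrite r15'; lia.
apply/runs_seq1/(runs_add (v := p + p + sigma + c)) => /=; [by rewrite r19'|lia|].
apply: (runs_read (v := occ (rcons (factor x i j) c))) => /=; first by lia.
  by rewrite r15' ifN_eq //; lia.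
rewrite r15'; split=> /=.
- by split; split=> //= l lt_lp; rewrite ifN_eq ?mem_x' //; lia.
- by [].
- move=> l lt_lp /=; rewrite eqn_add2l; have [->|ne_li] := eqVneq l i.
    by rewrite leqnn addn1 def_y.
  by rewrite leq_eqVlt eq_sym (negbTE ne_li); apply: startsP.
split; last by rewrite def_y.
by move=> a; rewrite /entry /= !ifN_eq; [apply: entryP|lia..].
Qed.

(** The separate clause on cell [p] also covers [p = 0], where [starts] says nothing. *)
Definition outer_inv (m : nat) (st : state) : Prop :=
  [/\ consts st, regs st 3 = m, starts p (p - m) st,
      block (factor x 0 (p - m)) (mem st p)
    & regs st 24 = occ (factor x 0 (p - m))].

Lemma outer_body_correct m st :
    p <= n -> p + p + sigma + sigma <= S -> m < p ->
    outer_inv m.+1 st ->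
  runs outer_body (p * (17 * sigma + 13) + 4) st (outer_inv m).
Proof.
move=> le_pn le_S lt_mp [] [[r0 r1 r2 r6] [r18 r19 r20 mem_x]] r3 startsP xb r24.
set j := p - m.+1 in startsP; have lt_jp : j < p by rewrite /j; lia.
have def_m : p - m = j.+1 by rewrite /j; lia.
apply: (@runs_le _ _ _ _ _ _ (2 + ((j.+1 * (17 * sigma + 12).+1).+1 + 1))).
  by have : j.+1 * (17 * sigma + 12).+1 <= p * (17 * sigma + 12).+1; [rewrite leq_mul2r; lia|lia].
apply/runs_seq1/(runs_sub (v := j)) => /=; [rewrite r2 r3 /j; lia|rewrite r2; lia|].
apply/runs_seq1/(runs_add (v := j.+1)) => /=; [by rewrite r6 addn1|lia|].
apply: runs_seq; apply: (runs_imp (Q := middle_inv j 0)); last first.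
  apply: runs_while => [m' st' [_ [_ _ ->] _ _] //|m' st' lt_m'|].
    by apply: middle_body_correct => //; lia.
  split=> //=; [split=> //=; rewrite r3 /j; lia| |by rewrite ltnn].
  (* For [l > j] the factors ending at [j] and at [j + 1] are both empty, so these cells count as
     already updated. *)
  move=> l lt_lp /=; have := startsP l lt_lp; rewrite leqNgt lt_lp addn0.
  by case: ltnP => lt_jl; [rewrite !factor_nil ?addn1 // ltnW|rewrite addn0].
move=> st' [] [[r0' r1' r2' r6'] [r18' r19' r20' mem_x']] [r3' r7' r4'].
move=> startsP' [//|_ r24'].
apply: (runs_sub (v := m)) => /=; [rewrite r3' r6' /j; lia|rewrite r3'; lia|].
split=> //=; rewrite def_m //.
  by move=> l lt_lp; have := startsP' l lt_lp; rewrite (leqNgt p) lt_lp leq0n addn1 addn0.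
by have := startsP' 0; rewrite addn1 addn0; apply; lia.
Qed.

(** The space condition is asked only for [0 < p]: for [p = 0] the available space does not grow
    with [sigma], and no table is touched. *)
Lemma range_prog_correct : 1 < 2 ^ w -> sigma < 2 ^ w -> 0 < S ->
    (0 < p -> p + p + sigma + sigma < S) ->
  runs range_prog (17 * sigma * p ^ 2 + 13 * p ^ 2 + 5 * p + 20) (init n x)
    (fun st => is_range (Mstar pi s) x (regs st 0) (regs st 1)).
Proof.
move=> gt1 lt_sw S_gt0 le_S.
have empty_range : ~~ has (prefix x) (Mstar pi s) -> is_range (Mstar pi s) x 0 0.
  move=> no_x; split=> // j; rewrite ltn0 andbF.
  have [/andP[j_gt0 le_j]|//] := boolP (0 < j <= _).
  by apply/negbTE/(hasPn no_x)/mem_nth; rewrite prednK.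
have lt_pw : p + p + sigma < 2 ^ w.
  by have [p0|/le_S] := posnP p; lia.
have le_pS : p < S by have [p0|/le_S] := posnP p; lia.
rewrite (_ : 17 * sigma * p ^ 2 + 13 * p ^ 2 + 5 * p + 20 =
             5 + (p * (p * (17 * sigma + 13) + 4).+1 + 15)); last by lia.
apply/runs_seq1/runs_const => //=.
apply/runs_seq1/(runs_add (v := p + p)) => /=; [by rewrite size_x|lia|].
apply/runs_seq1/(runs_add (v := p + p + sigma)) => //=.
apply/runs_seq1/(runs_add (v := n)) => //=; first by rewrite addn0.
apply/runs_seq1/runs_lt => //=; rewrite size_x.
rewrite (_ : _ + 15 = (p * (p * (17 * sigma + 13) + 4).+1 + 14).+1); last by lia.
apply: runs_if => /=; have [lt_np|le_pn] := ltnP n p => /=.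
  apply: (@runs_le _ _ _ _ _ _ 2); first by lia.
  apply/runs_seq1/runs_const => /=; first by lia.
  apply/runs_const => /=; first by lia.
  apply: empty_range; apply/hasPn => r /(size_Mstar_row size_s) size_r.
  by apply/negP => /size_prefix; rewrite size_x size_r; lia.
rewrite (_ : _ + 14 = 1 + ((p * (p * (17 * sigma + 13) + 4).+1).+1 + 12)); last by lia.
apply/runs_seq1/(runs_add (v := p)) => /=; [by rewrite addn0|lia|].
apply: runs_seq; apply: (runs_imp (Q := outer_inv 0)); last first.
  apply: runs_while => [m st' [_ -> _ _ _] //|m st' lt_m|].
    by apply: outer_body_correct => //; apply/ltnW/le_S; lia.
  split=> //=; rewrite ?subnn ?factor_nil ?(occ_nil _ size_s) //.
    (* Cells beyond the pattern initially hold 0, the start of the block of the empty string. *)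
    move=> l lt_lp /=; rewrite leqNgt lt_lp factor_nil //=.
    by rewrite nth_default ?size_map ?size_x ?leq_addr //; apply: block_nil.
  by rewrite nth_default ?size_map ?size_x //; apply: block_nil.
move=> st [] [[r0 r1 r2 r6] [r18 r19 r20 mem_x]] r3 startsP xb r24.
have def_x : factor x 0 p = x by rewrite /factor drop0 subn0 -size_x take_size.
rewrite subn0 def_x in xb r24.
apply: (@runs_le _ _ _ _ _ _ 4); first by [].
apply/runs_seq1/(runs_read (v := mem st p)) => /=; [by rewrite r2|by rewrite r2|].
(* An empty range must be reported as [0, 0], whereas the stored start of an empty block may be
   nonzero. *)
apply: runs_if => /=; rewrite r24; have [occ0|] := eqVneq (occ x) 0 => /=.
  apply/runs_seq1/runs_const => /=; first by lia.
  apply/runs_const => /=; first by lia.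
  by apply: empty_range; rewrite has_count -leqNgt; apply/eq_leq.
rewrite -lt0n => occ_gt0.
have [le_b _] := xb.
apply/runs_seq1/(runs_add (v := (mem st p).+1)) => /=; [by rewrite r6 addn1|lia|].
apply/(runs_add (v := occ x)) => /=; [by rewrite r20 r24 addn0|lia|].
exact: (block_range size_s).
Qed.

End Correctness.

(** * Time and space in terms of [sigma] and [p] *)

Theorem theorem8 (K : nat) :
  exists (P : prog) (Ct Cs : nat),
  forall (w sigma n p : nat) (s : n.-tuple 'I_sigma) (x : p.-tuple 'I_sigma)
         (pi : orderings sigma),
    sigma <= K * w ^ K ->
    n < 2 ^ w ->
    sigma < 2 ^ w ->
    Cs * (sigma * p + 1) <= 2 ^ w ->
    (forall y : seq 'I_sigma, total_order (pi y)) ->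
    primitive s ->
    exists (st : state) (t : nat),
      [/\ exec w (Cs * (sigma * p + 1)) (BWTstar pi s) pi P (init n x) st t,
          t <= Ct * (sigma * p ^ 2 + 1)
        & is_range (Mstar pi s) x (regs st 0) (regs st 1)].
Proof.
(* For [p > 0], [p <= p ^ 2 <= sigma * p ^ 2] bounds the time by [35 * sigma * p ^ 2 + 20], and
   [p, sigma <= sigma * p] bounds the cells used by [4 * sigma * p]. *)
exists range_prog, 40, 4 => w sigma n p s x pi _ lt_nw lt_sw le_Sw pi_total _.
(* A nonempty pattern contains a symbol, so the alphabet is nonempty. *)
have sigma_gt0 : 0 < p -> 0 < sigma.
  by move=> p_gt0; case: sigma x {s pi pi_total lt_sw le_Sw} => // x; case: (tnth x (Ordinal p_gt0)).
have gt1 : 1 < 2 ^ w by lia.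
have S_gt0 : 0 < 4 * (sigma * p + 1) by lia.
have le_S : 0 < p -> p + p + sigma + sigma < 4 * (sigma * p + 1).
  move=> p_gt0; have := sigma_gt0 p_gt0; have := p_gt0.
  have := leq_pmull p (sigma_gt0 p_gt0); have := leq_pmulr sigma p_gt0; lia.
have := range_prog_correct pi_total (size_tuple s) (size_tuple x) lt_nw le_Sw
  gt1 lt_sw S_gt0 le_S.
apply: runs_le.
have [->|p_gt0] := posnP p; first by lia.
have le_sp : p ^ 2 <= sigma * p ^ 2 by rewrite leq_pmull ?sigma_gt0.
have le_p : p <= p ^ 2 by rewrite expnS expn1 leq_pmull.
lia.
Qed.
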